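(* For integers $i\ge0$, $j_1\ge0$, $j_2\ge0$ and real $k_1,k_2$, $$\sum_{r=0}^{i}\binom{i}{r}c_{i-r,j_1,k_1}\,c_{r,j_2,k_2}=\binom{j_1+j_2}{j_1}c_{i,j_1+j_2,k_1+k_2}.$$
   Context: The signed Stirling numbers of the first kind $s_{i,r}$ are defined by $x(x-1)\cdots(x-i+1)=\sum_{r=0}^{i}s_{i,r}x^r$. For integers $i,j\ge0$ and real $k$, $c_{i,j,k}=\sum_{r=j}^{i}\binom{r}{j}(-k)^{r-j}s_{i,r}$ (zero if $j>i$). *)

(* Defs.v *)
(* The real numbers are an arbitrary [realType]. *)
From mathcomp Require Import all_boot all_order all_algebra reals.

Set Implicit Arguments.
Unset Strict Implicit.
Unset Printing Implicit Defensive.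

Import GRing.Theory.
Local Open Scope ring_scope.

Definition stirling1 (i r : nat) : int :=
  (\prod_(m < i) ('X - (m%:Z)%:P) : {poly int})`_r.

(* The defining identity x(x-1)...(x-i+1) = \sum_(0 <= r <= i) s_{i,r} x^r. *)
Lemma stirling1_def (i : nat) :
  \prod_(m < i) ('X - (m%:Z)%:P) =
    \sum_(r < i.+1) stirling1 i r *: 'X^r :> {poly int}.
Proof.
rewrite -poly_def; apply/polyP => r; rewrite coef_poly /stirling1.
case: ltnP => // lt_ir; apply: nth_default.
by rewrite size_prod_XsubC -[index_enum _]enumT size_enum_ord.
Qed.

(* The range is empty when i < j, so that c_{i,j,k} = 0 in that case;
   0 ^+ 0 = 1, so that c_{i,j,0} = s_{i,j}. *)
Definition stirling_c (R : realType) (i j : nat) (k : R) : R :=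
  \sum_(j <= r < i.+1) 'C(r, j)%:R * (- k) ^+ (r - j) * (stirling1 i r)%:~R.

(* Main.v *)
(** [c_{i,j,k}] is the coefficient of [X^j] in the falling factorial
    [(X - k)_i]. By the Vandermonde identity for falling factorials, the
    left-hand side is the coefficient of [X^j1 Y^j2] in
    [(X + Y - k1 - k2)_i], and for any polynomial [p] the coefficient of
    [X^j1 Y^j2] in [p(X + Y)] is ['C(j1 + j2, j1)] times that of [X^(j1 + j2)]
    in [p]. *)
Require Import Defs.
From mathcomp Require Import all_boot all_order all_algebra reals.
From mathcomp Require Import ring.
Import GRing.Theory.
Local Open Scope ring_scope.

Definition falling {A : comNzRingType} (u : A) (n : nat) : A :=
  \prod_(m < n) (u - m%:R).

Lemma fallingS (A : comNzRingType) (u : A) n :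
  falling u n.+1 = falling u n * (u - n%:R).
Proof. exact: big_ord_recr. Qed.

Lemma rmorph_falling (A B : comNzRingType) (f : {rmorphism A -> B}) u n :
  f (falling u n) = falling (f u) n.
Proof.
by rewrite rmorph_prod; apply: eq_bigr => m _; rewrite rmorphB rmorph_nat.
Qed.

(** Induction on [n]: Pascal's rule matches the splitting [u + v - n = (u - (n - r)) + (v - r)] of
    the new factor in the [r]-th term. *)
Lemma falling_vandermonde (A : comNzRingType) (u v : A) n :
  falling (u + v) n =
    \sum_(r < n.+1) 'C(n, r)%:R * falling u (n - r) * falling v r.
Proof.
elim: n => [|n IHn].
  by rewrite big_ord1 bin0 /falling !big_ord0 !mul1r.
rewrite fallingS IHn mulr_suml [RHS]big_ord_recl /= bin0.
under [in RHS]eq_bigr => r _ do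
  rewrite /bump /= add1n binS natrD subSS !mulrDl.
rewrite big_split /= addrA.
(* The isolated term is the case [r = 0] of the sum on the right; the top term on the left vanishes
   since ['C(n, n.+1) = 0]. *)
have -> : 1%:R * falling u (n.+1 - 0) * falling v 0 +
    \sum_(r < n.+1) 'C(n, r.+1)%:R * falling u (n - r) * falling v r.+1 =
    \sum_(r < n.+1) 'C(n, r)%:R * falling u (n.+1 - r) * falling v r.
  rewrite [in RHS]big_ord_recl bin0 big_ord_recr /= bin_small // !mul0r addr0.
  by congr (_ + _); apply: eq_bigr => r _; rewrite /bump /= add1n subSS.
rewrite -big_split /=; apply: eq_bigr => r _.
have le_rn : (r <= n)%N by rewrite -ltnS.
rewrite subSn // !fallingS natrB //.
by ring.
Qed.

Lemma coef_comp_XaddC (A : comNzRingType) (p : {poly A}) (c : A) j :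
  (p \Po ('X + c%:P))`_j = p^`N(j).[c].
Proof.
(* Taylor expansion at [c], long enough to contain degree [j] even when [j] is at least [size p]. *)
rewrite /comp_poly addrC (nderiv_taylor_wide (n := size p + j.+1)); first last.
- by rewrite size_map_polyC leq_addr.
- exact: mulrC.
under eq_bigr => i _ do rewrite nderivn_map horner_map /=.
under eq_bigr => i _ do rewrite mul_polyC.
rewrite -(poly_def _ (fun i => p^`N(i).[c])) coef_poly ifT //.
by rewrite addnS ltnS leq_addl.
Qed.

Lemma coef_comp_XaddY (A : comNzRingType) (p : {poly A}) j1 j2 :
  (p^:P \Po ('X + ('X)%:P))`_j2`_j1 = 'C(j1 + j2, j1)%:R * p`_(j1 + j2).
Proof.
rewrite coef_comp_XaddC nderivn_map -/(comp_poly 'X _) comp_polyXr.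
by rewrite coef_nderivn addnC -bin_sub ?leq_addl // addnK mulr_natl.
Qed.

Lemma coef_falling_X (A : comNzRingType) i r :
  (falling ('X : {poly A}) i)`_r = (stirling1 i r)%:~R.
Proof.
rewrite /stirling1 -[RHS](coef_map intr) rmorph_prod /=; congr (polyseq _)`_r.
by apply: eq_bigr => m _; rewrite map_polyXsubC /= -pmulrn rmorph_nat.
Qed.

Lemma size_falling_X (A : comNzRingType) i :
  size (falling ('X : {poly A}) i) = i.+1.
Proof.
rewrite /falling; under eq_bigr => m _ do rewrite -polyC_natr.
by rewrite size_prod_XsubC -[index_enum _]enumT size_enum_ord.
Qed.

Lemma falling_X_comp (A : comNzRingType) (q : {poly A}) i :
  falling 'X i \Po q = falling q i.
Proof. by rewrite (rmorph_falling _ _ (comp_poly q)) /= comp_polyX. Qed.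

Lemma stirling_cE (R : realType) i j (k : R) :
  stirling_c i j k = (falling ('X - k%:P) i)`_j.
Proof.
rewrite -falling_X_comp -polyCN coef_comp_XaddC.
(* This length matches the range from [j] to [i]; both sums are empty when [i < j]. *)
rewrite (horner_coef_wide (n := i.+1 - j)); last first.
  by rewrite /nderivn (leq_trans (size_poly _ _)) // size_falling_X.
rewrite /stirling_c -{1}[j]add0n big_addn big_mkord; apply: eq_bigr => r _.
by rewrite coef_nderivn coef_falling_X addnK addnC -mulr_natl; ring.
Qed.

Theorem theorem2p11 (R : realType) (i j1 j2 : nat) (k1 k2 : R) :
  \sum_(0 <= r < i.+1)
     'C(i, r)%:R * stirling_c (i - r) j1 k1 * stirling_c r j2 k2 =
  'C(j1 + j2, j1)%:R * stirling_c i (j1 + j2) (k1 + k2).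
Proof.
(* [u] is [X - k1], constant in Y, and [v] is [Y - k2], free of X. *)
pose u : {poly {poly R}} := ('X - k1%:P)%:P.
pose v : {poly {poly R}} := ('X - k2%:P)^:P.
rewrite stirling_cE -coef_comp_XaddY.
rewrite (rmorph_falling _ _ (map_poly polyC)).
rewrite (rmorph_falling _ _ (comp_poly ('X + ('X)%:P))) /=.
have -> : ('X - (k1 + k2)%:P)^:P \Po ('X + ('X)%:P) = u + v.
  rewrite /u /v !map_polyXsubC comp_polyB comp_polyX comp_polyC /=.
  by rewrite !polyCD !polyCN; ring.
rewrite falling_vandermonde !coef_sum big_mkord; apply: eq_bigr => r _.
(* The two factors involve separate variables, so the coefficient of [X^j1 Y^j2] in their product is
   a product of coefficients. *)
rewrite /u /v -(rmorph_falling _ _ polyC) -(rmorph_falling _ _ (map_poly polyC)).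
rewrite -!mulrA !mulr_natl !coefMn coefCM coef_map /= coefMC.
by rewrite !stirling_cE.
Qed.
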